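(* Any bi-quartic parametric polynomial minimal surface in isothermal parameters is generated by the Weierstrass formula with the functions $$f(z)=Az+B,\qquad g(z)=Cz+D,\qquad\text{where } A\neq 0,\ C\neq 0,$$ and $A,B,C,D$ are complex constants.
   Context: A regular surface in $\mathbb{R}^3$ is given locally by a chart $\mathbf{x}=\mathbf{x}(u,v)$, $(u,v)\in U\subset\mathbb{R}^2$. The coefficients of the first fundamental form are $E=\mathbf{x}_u\cdot\mathbf{x}_u$, $F=\mathbf{x}_u\cdot\mathbf{x}_v$, $G=\mathbf{x}_v\cdot\mathbf{x}_v$. With unit normal $\mathbf{U}=\frac{\mathbf{x}_u\times\mathbf{x}_v}{|\mathbf{x}_u\times\mathbf{x}_v|}$, the coefficients of the second fundamental form are $L=\mathbf{U}\cdot\mathbf{x}_{uu}$, $M=\mathbf{U}\cdot\mathbf{x}_{uv}$, $N=\mathbf{U}\cdot\mathbf{x}_{vv}$. The mean curvature is $H=\frac{EN-2FM+GL}{2(EG-F^2)}$, and the surface is minimal if $H$ vanishes identically. The parameters $(u,v)$ (or the chart) are isothermal if $E=G$ and $F=0$. A bi-quartic parametric polynomial surface is one given by a chart $\mathbf{x}(u,v)=\sum_{i,j=0}^{4}\mathbf{v}_{ij}\,u^iv^j$ with $\mathbf{v}_{ij}\in\mathbb{R}^3$, of degree $4$ in both $u$ and $v$. The Weierstrass formula with holomorphic functions $f,g$ is $$\Psi(z)=\int_{z_0}^{z}\Bigl(\tfrac12 f(z)\bigl(1-g^2(z)\bigr),\ \tfrac{i}{2}f(z)\bigl(1+g^2(z)\bigr),\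 f(z)g(z)\Bigr)\,dz,\qquad z=u+iv,$$ and the surface generated by it is the one with chart $\mathbf{x}(u,v)=\operatorname{Re}\Psi(z)$.
   Formalization: The surface is assumed not to lie in a plane, and ''is generated by'' is read up to a rotation and translation of space; without these the claim fails, e.g. for (Re z^4, Im z^4, 0) and for the surface with f = z^3, g = 1/z. *)

(* Defs.v *)
From Stdlib Require Import Reals.
From Coquelicot Require Import Coquelicot.

Open Scope R_scope.

(* Vectors of R^3 are triples, with Coquelicot's normed-module structure on
   products providing [plus], [scal] and [zero]. *)
Definition vec : Type := (R * R * R)%type.

Definition vx (p : vec) : R := fst (fst p).
Definition vy (p : vec) : R := snd (fst p).
Definition vz (p : vec) : R := snd p.

Definition dot (p q : vec) : R := vx p * vx q + vy p * vy q + vz p * vz q.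

Definition cross (p q : vec) : vec :=
  (vy p * vz q - vz p * vy q,
   vz p * vx q - vx p * vz q,
   vx p * vy q - vy p * vx q).

(* A chart is a total function of (u, v); only its values on the open domain U
   matter. *)
Definition chart : Type := R -> R -> vec.

Definition d_u (x : chart) : chart := fun u v =>
  (Derive (fun s => vx (x s v)) u,
   Derive (fun s => vy (x s v)) u,
   Derive (fun s => vz (x s v)) u).

Definition d_v (x : chart) : chart := fun u v =>
  (Derive (fun s => vx (x u s)) v,
   Derive (fun s => vy (x u s)) v,
   Derive (fun s => vz (x u s)) v).

Definition coefE (x : chart) (u v : R) : R := dot (d_u x u v) (d_u x u v).
Definition coefF (x : chart) (u v : R) : R := dot (d_u x u v) (d_v x u v).
Definition coefG (x : chart) (u v : R) : R := dot (d_v x u v) (d_v x u v).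

Definition unit_normal (x : chart) (u v : R) : vec :=
  let n := cross (d_u x u v) (d_v x u v) in scal (/ sqrt (dot n n)) n.

(* [d_v (d_u x)] is x_uv: first u, then v. *)
Definition coefL (x : chart) (u v : R) : R :=
  dot (unit_normal x u v) (d_u (d_u x) u v).
Definition coefM (x : chart) (u v : R) : R :=
  dot (unit_normal x u v) (d_v (d_u x) u v).
Definition coefN (x : chart) (u v : R) : R :=
  dot (unit_normal x u v) (d_v (d_v x) u v).

Definition mean_curvature (x : chart) (u v : R) : R :=
  (coefE x u v * coefN x u v - 2 * coefF x u v * coefM x u v
     + coefG x u v * coefL x u v)
  / (2 * (coefE x u v * coefG x u v - coefF x u v ^ 2)).

Definition regular_on (U : R * R -> Prop) (x : chart) : Prop :=
  forall u v : R, U (u, v) -> cross (d_u x u v) (d_v x u v) <> zero.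

Definition minimal_on (U : R * R -> Prop) (x : chart) : Prop :=
  forall u v : R, U (u, v) -> mean_curvature x u v = 0.

Definition isothermal_on (U : R * R -> Prop) (x : chart) : Prop :=
  forall u v : R, U (u, v) ->
    coefE x u v = coefG x u v /\ coefF x u v = 0.

(* [sum_n a 4] is a 0 + ... + a 4.  The degree is exactly 4 in u and exactly 4
   in v: some u^4 v^j and some u^i v^4 have a nonzero coefficient. *)
Definition biquartic_on (U : R * R -> Prop) (x : chart) : Prop :=
  exists c : nat -> nat -> vec,
    (exists j : nat, (j <= 4)%nat /\ c 4%nat j <> zero) /\
    (exists i : nat, (i <= 4)%nat /\ c i 4%nat <> zero) /\
    forall u v : R, U (u, v) ->
      x u v = sum_n (fun i => sum_n (fun j => scal (u ^ i * v ^ j) (c i j)) 4) 4.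

Definition planar_on (U : R * R -> Prop) (x : chart) : Prop :=
  exists (n : vec) (d : R), n <> zero /\
    forall u v : R, U (u, v) -> dot n (x u v) = d.

(* A linear map of R^3 preserving both products is an element of SO(3), so
   these are the orientation-preserving isometries. *)
Definition rigid_motion (T : vec -> vec) : Prop :=
  exists (Q : vec -> vec) (b : vec),
    is_linear Q /\
    (forall p q : vec, dot (Q p) (Q q) = dot p q) /\
    (forall p q : vec, Q (cross p q) = cross (Q p) (Q q)) /\
    forall p : vec, T p = plus (Q p) b.

(* The integral of h from z0 to z along the straight segment; for h holomorphic
   on a simply connected domain containing that segment, every other path in
   the domain gives the same value. *)
Definition CInt (h : C -> C) (z0 z : C) : C :=
  ((z - z0) *
   RInt (V := C_R_CompleteNormedModule)
     (fun t : R => h (z0 + RtoC t * (z - z0))) 0 1)%C.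

Definition weierstrass (f g : C -> C) (z0 z : C) : C * C * C :=
  (CInt (fun w => RtoC (1 / 2) * f w * (1 - g w * g w))%C z0 z,
   CInt (fun w => Ci / 2 * f w * (1 + g w * g w))%C z0 z,
   CInt (fun w => f w * g w)%C z0 z).

Definition weierstrass_chart (f g : C -> C) (z0 : C) : chart := fun u v =>
  let Psi := weierstrass f g z0 (u, v) in
  (Re (fst (fst Psi)), Re (snd (fst Psi)), Re (snd Psi)).

(* Main.v *)
Require Import Defs.
From Stdlib Require Import Reals Lra Lia List Classical FunctionalExtensionality.
From Coquelicot Require Import Coquelicot.
Import ListNotations.
Open Scope R_scope.

(** In isothermal parameters the mean curvature is, up to a nonzero factor, the
    normal component of the Laplacian of the chart, while the tangential
    components of the Laplacian vanish because [E = G] and [F = 0]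
    ([laplacian_chart_zero]).  So the coordinates of an isothermal minimal chart
    are harmonic.

    A harmonic polynomial of degree at most 4 in each variable has total degree
    at most 4 ([harmonic_coefs]); it is therefore a constant plus the real part
    of a primitive of a cubic polynomial in [z = u + i v], namely [h_u - i h_v]
    ([wirtinger_eval], [antideriv_eval]).  The three cubics obtained from the
    coordinates of the chart form a curve in complex 3-space; its sum of squares
    is [E - G - 2 i F], which vanishes on the domain and so identically: the curve
    is isotropic.  Since the chart has degree 4 in [u], the leading coefficient of
    the curve does not vanish; it is itself an isotropic vector, and a rotation
    brings it to a multiple of [(-1, i, 0)] ([isotropic_frame]).

    After this rotation the components [a], [b], [c] satisfy
    [(a - i b) (a + i b) = - c^2], where [a + i b] has degree 3 and [c] degree at
    most 2.  Comparing degrees, either [c = 0], and the surface is planar, or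
    [a - i b] has degree 1 and divides [c].  Then [f = a - i b] and [g = c / f] are
    linear with nonzero slopes and are the Weierstrass data
    ([isotropic_cubic_weierstrass]).  Undoing the rotation and adding the constant
    of integration is the rigid motion [T]. *)

(** * Polynomials with infinitely many zeros *)

Fixpoint horner (l : list C) (z : C) : C :=
  match l with
  | [] => 0%C
  | a :: l' => (a + z * horner l' z)%C
  end.

(** Avoiding every finite list is the form in which infinity is both easy to
    verify and inherited after the removal of a point. *)
Definition infinite (S : C -> Prop) : Prop :=
  forall l : list C, exists z, S z /\ ~ In z l.

Lemma Cmult_zero (a b : C) : (a * b)%C = 0%C -> a = 0%C \/ b = 0%C.
Proof.
  intros H.
  destruct (classic (a = 0%C)) as [Ha | Ha]; [now left | right].
  replace b with (/ a * (a * b))%C by now field.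
  rewrite H; ring.
Qed.

Lemma infinite_remove (S : C -> Prop) (w : C) :
  infinite S -> infinite (fun z => S z /\ z <> w).
Proof.
  intros HS l. destruct (HS (w :: l)) as [z [Hz Hn]].
  exists z; simpl in Hn; repeat split; auto; intro; apply Hn; auto.
Qed.

Lemma horner_factor (w a : C) (l : list C) :
  exists q, length q = length l /\
    forall z, horner (a :: l) z = (horner (a :: l) w + (z - w) * horner q z)%C.
Proof.
  revert a; induction l as [|b l IH]; intro a.
  - exists []; split; [reflexivity | intro z; simpl; ring].
  - destruct (IH b) as [q [Hl Hq]].
    exists (horner (b :: l) w :: q); split; [simpl; congruence|].
    intro z.
    change (horner (a :: b :: l) z) with (a + z * horner (b :: l) z)%C.
    change (horner (a :: b :: l) w) with (a + w * horner (b :: l) w)%C.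
    change (horner (horner (b :: l) w :: q) z)
      with (horner (b :: l) w + z * horner q z)%C.
    rewrite (Hq z); ring.
Qed.

(** Each zero splits off a linear factor, so a polynomial with infinitely many
    zeros is exhausted by induction on the number of its coefficients. *)
Lemma horner_zero_ext (l : list C) (S : C -> Prop) :
  infinite S -> (forall z, S z -> horner l z = 0%C) -> forall z, horner l z = 0%C.
Proof.
  remember (length l) as n eqn:Hn.
  revert l Hn S; induction n as [|n IH]; intros [|a l] Hn S HS H z;
    try reflexivity; try discriminate.
  destruct (HS []) as [w [Hw _]].
  destruct (horner_factor w a l) as [q [Hl Hq]].
  rewrite Hq, (H w Hw).
  rewrite (IH q) with (S := fun z : C => S z /\ z <> w).
  - ring.
  - injection Hn; congruence.
  - now apply infinite_remove.
  - intros y [Hy Hyw]. specialize (Hq y). rewrite (H y Hy), (H w Hw) in Hq.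
    destruct (Cmult_zero (y - w)%C (horner q y)) as [E | E]; auto.
    + rewrite Hq; ring.
    + contradict Hyw. replace y with ((y - w) + w)%C by ring. rewrite E; ring.
Qed.

Lemma infinite_segment (v a b : R) :
  a < b -> infinite (fun z : C => exists t, a < t < b /\ z = (t, v)).
Proof.
  intros Hab l.
  (* each point of the list is avoided by passing to a half of the segment *)
  assert (K : exists a' b', a <= a' /\ a' < b' /\ b' <= b /\
                forall t, a' < t < b' -> ~ In (t, v) l).
  { induction l as [|w l [a' [b' (H1 & H2 & H3 & H4)]]].
    - exists a, b; repeat split; auto with real.
    - destruct (Rle_dec (fst w) ((a' + b') / 2)) as [Hw | Hw].
      + exists ((a' + b') / 2), b'; repeat split; try lra.
        intros t Ht [E | E]; [subst w; simpl in Hw; lra | apply (H4 t); auto; lra].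
      + exists a', ((a' + b') / 2); repeat split; try lra.
        intros t Ht [E | E]; [subst w; simpl in Hw; lra | apply (H4 t); auto; lra]. }
  destruct K as [a' [b' (H1 & H2 & H3 & H4)]].
  exists ((a' + b') / 2, v); split; [exists ((a' + b') / 2); split; auto; lra|].
  apply H4; lra.
Qed.

(** Evaluating at 0 kills the constant coefficient; the rest of the polynomial
    then vanishes off 0, hence everywhere. *)
Lemma horner_coef_zero (l : list C) (S : C -> Prop) :
  infinite S -> (forall z, S z -> horner l z = 0%C) -> List.Forall (fun a : C => a = 0%C) l.
Proof.
  intros HS H. assert (H0 := horner_zero_ext l S HS H); clear S HS H.
  induction l as [|a l IH]; constructor.
  - rewrite <- (H0 0%C); cbn [horner]; ring.
  - apply IH. apply horner_zero_ext with (S := fun z : C => True /\ z <> 0%C).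
    + apply infinite_remove. intro l'.
      destruct (infinite_segment 0 0 1 Rlt_0_1 l') as [z [_ Hz]]; eauto.
    + intros z [_ Hz]. assert (E : (z * horner l z)%C = 0%C).
      { assert (Ha : a = 0%C) by (rewrite <- (H0 0%C); cbn [horner]; ring).
        specialize (H0 z); cbn [horner] in H0; rewrite Ha in H0; rewrite <- H0; ring. }
      destruct (Cmult_zero _ _ E); tauto.
Qed.

Lemma horner_coef_zero_all (l : list C) :
  (forall z, horner l z = 0%C) -> List.Forall (fun a : C => a = 0%C) l.
Proof.
  intro H; apply horner_coef_zero with (S := fun z : C => exists t, 0 < t < 1 /\ z = (t, 0)).
  - apply infinite_segment; lra.
  - auto.
Qed.

(** * Real biquartic polynomials *)

(** The coefficient array [c] is indexed by all pairs of naturals so that partial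
    derivatives are shifts of [c], without change of the range of summation. *)
Definition bipoly (c : nat -> nat -> R) (u v : R) : R :=
  sum_n (fun i => sum_n (fun j => u ^ i * v ^ j * c i j) 4) 4.

Definition du (c : nat -> nat -> R) : nat -> nat -> R :=
  fun i j => INR (S i) * c (S i) j.
Definition dv (c : nat -> nat -> R) : nat -> nat -> R :=
  fun i j => INR (S j) * c i (S j).

Definition quartic (c : nat -> nat -> R) : Prop :=
  forall i j, (4 < i \/ 4 < j)%nat -> c i j = 0.

Lemma quartic_du c : quartic c -> quartic (du c).
Proof. intros H i j Hij. unfold du. rewrite H; [ring | lia]. Qed.

Lemma quartic_dv c : quartic c -> quartic (dv c).
Proof. intros H i j Hij. unfold dv. rewrite H; [ring | lia]. Qed.

Ltac expand_bipoly :=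
  unfold bipoly; repeat (rewrite ?sum_Sn, ?sum_O); unfold plus; cbn -[INR pow].

Lemma is_derive_bipoly_u c u v : quartic c ->
  is_derive (fun s => bipoly c s v) u (bipoly (du c) u v).
Proof.
  intro H.
  replace (bipoly (du c) u v) with
    (sum_n (fun i => sum_n (fun j => INR i * u ^ pred i * v ^ j * c i j) 4) 4).
  - unfold bipoly. apply @is_derive_sum_n; intros i _. apply @is_derive_sum_n; intros j _.
    auto_derive; auto. ring.
  - expand_bipoly. unfold du. rewrite !(H 5%nat) by lia. simpl. ring.
Qed.

Lemma is_derive_bipoly_v c u v : quartic c ->
  is_derive (fun s => bipoly c u s) v (bipoly (dv c) u v).
Proof.
  intro H.
  replace (bipoly (dv c) u v) with
    (sum_n (fun i => sum_n (fun j => INR j * u ^ i * v ^ pred j * c i j) 4) 4).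
  - unfold bipoly. apply @is_derive_sum_n; intros i _. apply @is_derive_sum_n; intros j _.
    auto_derive; auto. ring.
  - expand_bipoly. unfold dv. rewrite !(H _ 5%nat) by lia. simpl. ring.
Qed.

Definition square (u0 v0 e : R) (u v : R) : Prop :=
  Rabs (u - u0) < e /\ Rabs (v - v0) < e.

(** The coefficient of [u ^ i] in [bipoly c u v]. *)
Definition row (c : nat -> nat -> R) (v : R) (i : nat) : R :=
  c i 0%nat + v * (c i 1%nat + v * (c i 2%nat + v * (c i 3%nat + v * c i 4%nat))).

Lemma real_coefs_zero (f : nat -> R) n :
  List.Forall (fun a : C => a = 0%C) (map (fun i => RtoC (f i)) (seq 0 n)) ->
  forall i, (i < n)%nat -> f i = 0.
Proof.
  intros H i Hi. rewrite Forall_forall in H. apply RtoC_inj, H.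
  apply in_map_iff; exists i; split; auto. apply in_seq; lia.
Qed.

Lemma real_poly_zero (f : nat -> R) (a b : R) : a < b ->
  (forall t, a < t < b ->
    f 0%nat + t * (f 1%nat + t * (f 2%nat + t * (f 3%nat + t * f 4%nat))) = 0) ->
  forall i, (i < 5)%nat -> f i = 0.
Proof.
  intros Hab H. apply real_coefs_zero.
  apply horner_coef_zero with (1 := infinite_segment 0 a b Hab).
  intros z [t [Ht ->]]. simpl.
  change (t, 0) with (RtoC t).
  rewrite Cmult_0_r, Cplus_0_r, <- !RtoC_mult, <- !RtoC_plus.
  repeat (rewrite <- !RtoC_mult, <- !RtoC_plus).
  now rewrite H.
Qed.

(** A polynomial in [u] whose coefficients are polynomials in [v]: the
    one-variable case applies twice. *)
Lemma bipoly_zero c u0 v0 e : 0 < e ->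
  (forall u v, square u0 v0 e u v -> bipoly c u v = 0) ->
  forall i j, (i < 5)%nat -> (j < 5)%nat -> c i j = 0.
Proof.
  intros He H i j Hi Hj.
  apply (real_poly_zero (c i) (v0 - e) (v0 + e)); auto; [lra|].
  intros v Hv. change (row c v i = 0).
  apply (real_poly_zero (row c v) (u0 - e) (u0 + e)); auto; [lra|].
  intros u Hu. rewrite <- (H u v).
  - expand_bipoly. unfold row. simpl. ring.
  - split; apply Rabs_def1; lra.
Qed.

(** * Harmonic biquartics as real parts *)

Definition cubic (b : nat -> C) (z : C) : C :=
  (b 0%nat + z * (b 1%nat + z * (b 2%nat + z * b 3%nat)))%C.
Definition antideriv (b : nat -> C) (z : C) : C :=
  (z * (b 0%nat + z * (b 1%nat / 2 + z * (b 2%nat / 3 + z * (b 3%nat / 4)))))%C.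

Definition laplacian (c : nat -> nat -> R) : nat -> nat -> R :=
  fun i j => du (du c) i j + dv (dv c) i j.

(** For harmonic [h] with coefficients [c], the function [h_u - i h_v] is a
    polynomial in [z]; restricting to the real axis gives its coefficients. *)
Definition wirtinger (c : nat -> nat -> R) (k : nat) : C :=
  (du c k 0%nat, - dv c k 0%nat).

Lemma bipoly_plus a b u v :
  bipoly (fun i j => a i j + b i j) u v = bipoly a u v + bipoly b u v.
Proof.
  unfold bipoly. rewrite <- (sum_n_plus (G := R_AbelianMonoid)).
  apply sum_n_ext; intro i. rewrite <- (sum_n_plus (G := R_AbelianMonoid)).
  apply sum_n_ext; intro j. unfold plus; simpl; ring.
Qed.

Definition harmonic (c : nat -> nat -> R) : Prop :=
  quartic c /\ forall i j, (i < 5)%nat -> (j < 5)%nat -> laplacian c i j = 0.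

Ltac instance K i j := pose proof (K i j ltac:(lia) ltac:(lia)).

(** The Laplace equation links [c (i+2) j] to [c i (j+2)].  Going down such a
    chain, of total degree 5 or more, ends at a coefficient of degree above 4 in
    one variable, so the whole chain vanishes: a harmonic biquartic has total
    degree at most 4. *)
Lemma harmonic_coefs c : harmonic c ->
  (forall i j, (4 < i + j)%nat -> c i j = 0) /\
  c 0%nat 2%nat = - c 2%nat 0%nat /\
  c 1%nat 2%nat = - 3 * c 3%nat 0%nat /\
  c 2%nat 1%nat = - 3 * c 0%nat 3%nat /\
  c 2%nat 2%nat = - 6 * c 4%nat 0%nat /\
  c 0%nat 4%nat = c 4%nat 0%nat /\
  c 3%nat 1%nat = - c 1%nat 3%nat.
Proof.
  intros [Hb H].
  assert (K : forall i j, (i < 5)%nat -> (j < 5)%nat ->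
     (INR i + 1) * (INR i + 2) * c (S (S i)) j + (INR j + 1) * (INR j + 2) * c i (S (S j)) = 0).
  { intros i j Hi Hj. rewrite <- (H i j Hi Hj). unfold laplacian, du, dv.
    rewrite !S_INR. ring. }
  clear H.
  assert (Hi : forall i j, (4 < i)%nat -> c i j = 0) by (intros; apply Hb; auto).
  assert (Hj : forall i j, (4 < j)%nat -> c i j = 0) by (intros; apply Hb; auto).
  instance K 0%nat 0%nat. instance K 1%nat 0%nat. instance K 2%nat 0%nat. instance K 3%nat 0%nat.
  instance K 4%nat 0%nat. instance K 0%nat 1%nat. instance K 1%nat 1%nat. instance K 2%nat 1%nat.
  instance K 3%nat 1%nat. instance K 4%nat 1%nat. instance K 0%nat 2%nat. instance K 1%nat 2%nat.
  instance K 2%nat 2%nat. instance K 3%nat 2%nat. instance K 4%nat 2%nat. instance K 0%nat 3%nat.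
  clear K.
  simpl INR in *.
  rewrite ?(Hi 5%nat), ?(Hi 6%nat), ?(Hj _ 5%nat), ?(Hj _ 6%nat) in * by lia.
  split; [|repeat split; lra].
  intros i j Hij.
  destruct (Compare_dec.le_lt_dec i 4) as [Li|]; [|auto].
  destruct (Compare_dec.le_lt_dec j 4) as [Lj|]; [|auto].
  destruct i as [|[|[|[|[|i]]]]]; try lia;
  destruct j as [|[|[|[|[|j]]]]]; try lia; lra.
Qed.

Ltac harmonic_coefs H :=
  let H0 := fresh in
  destruct (harmonic_coefs _ H) as (H0 & ? & ? & ? & ? & ? & ?);
  repeat match goal with
  | |- context [?c ?i ?j] => rewrite (H0 i j) by lia
  | E : ?c ?i ?j = _ |- context [?c ?i ?j] => rewrite E
  end.

Lemma wirtinger_eval c u v : harmonic c ->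
  cubic (wirtinger c) (u, v) = (bipoly (du c) u v, - bipoly (dv c) u v).
Proof.
  intros H. unfold cubic, wirtinger.
  apply injective_projections; expand_bipoly; unfold du, dv; harmonic_coefs H;
    simpl; ring.
Qed.

(** A harmonic function is determined up to a constant by [h_u - i h_v]: it is
    the real part of a primitive of that function. *)
Lemma antideriv_eval c u v : harmonic c ->
  bipoly c u v = c 0%nat 0%nat + Re (antideriv (wirtinger c) (u, v)).
Proof.
  intros H. unfold antideriv, wirtinger. expand_bipoly; unfold du, dv.
  harmonic_coefs H. simpl. field.
Qed.

(** * Vectors *)

Lemma vec_ext (p q : vec) : vx p = vx q -> vy p = vy q -> vz p = vz q -> p = q.
Proof. destruct p as [[? ?] ?], q as [[? ?] ?]; unfold vx, vy, vz; simpl; congruence. Qed.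

Lemma vx_plus (p q : vec) : vx (plus p q) = vx p + vx q.
Proof. reflexivity. Qed.
Lemma vy_plus (p q : vec) : vy (plus p q) = vy p + vy q.
Proof. reflexivity. Qed.
Lemma vz_plus (p q : vec) : vz (plus p q) = vz p + vz q.
Proof. reflexivity. Qed.
Lemma vx_scal (k : R) (p : vec) : vx (scal k p) = k * vx p.
Proof. reflexivity. Qed.
Lemma vy_scal (k : R) (p : vec) : vy (scal k p) = k * vy p.
Proof. reflexivity. Qed.
Lemma vz_scal (k : R) (p : vec) : vz (scal k p) = k * vz p.
Proof. reflexivity. Qed.

Ltac vec_coords :=
  unfold dot, cross in *; cbn [vx vy vz fst snd] in *;
  rewrite ?vx_plus, ?vy_plus, ?vz_plus, ?vx_scal, ?vy_scal, ?vz_scal in *.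

Ltac vec_ring := try apply vec_ext; vec_coords; unfold vx, vy, vz in *; cbn [fst snd] in *; ring.

Lemma dot_self_pos (p : vec) : p <> zero -> 0 < dot p p.
Proof.
  intro H. destruct p as [[a b] c]. unfold dot, vx, vy, vz; cbn [fst snd].
  destruct (Req_dec a 0) as [->|]; [|nra].
  destruct (Req_dec b 0) as [->|]; [|nra].
  destruct (Req_dec c 0) as [->|]; [|nra].
  now contradict H.
Qed.

Lemma cross_basis (p q w : vec) :
  scal (dot (cross p q) (cross p q)) w =
  plus (plus (scal (dot w p) (cross q (cross p q))) (scal (dot w q) (cross (cross p q) p)))
       (scal (dot w (cross p q)) (cross p q)).
Proof. vec_ring. Qed.

Lemma dot_cross_self (p q : vec) :
  dot (cross p q) (cross p q) = dot p p * dot q q - dot p q ^ 2.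
Proof. vec_ring. Qed.

(** Two vectors and their nonzero cross product span the space; [cross_basis]
    expands any vector in them. *)
Lemma orthogonal_to_basis (p q w : vec) :
  cross p q <> zero -> dot w p = 0 -> dot w q = 0 -> dot w (cross p q) = 0 -> w = zero.
Proof.
  intros Hn Hp Hq Hc. assert (H := cross_basis p q w).
  assert (Hpos := dot_self_pos _ Hn).
  rewrite Hp, Hq, Hc in H.
  set (k := dot (cross p q) (cross p q)) in Hpos, H.
  assert (K : forall f : vec -> R, (forall a r, f (scal a r) = a * f r) ->
    (forall r s, f (plus r s) = f r + f s) -> f w = 0).
  { intros f Hf1 Hf2. apply (f_equal f) in H.
    rewrite !Hf2, !Hf1 in H. apply Rmult_eq_reg_l with k; lra. }
  apply vec_ext; apply K; reflexivity.
Qed.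

(** * Isothermal minimal charts are harmonic *)

(** Stated on coordinates because [d_u] and [d_v] are. *)
Definition is_vderive (f : R -> vec) (t : R) (d : vec) : Prop :=
  is_derive (fun s => vx (f s)) t (vx d) /\
  is_derive (fun s => vy (f s)) t (vy d) /\
  is_derive (fun s => vz (f s)) t (vz d).

Lemma is_derive_dot f g t df dg : is_vderive f t df -> is_vderive g t dg ->
  is_derive (fun s => dot (f s) (g s)) t (dot df (g t) + dot (f t) dg).
Proof.
  assert (M : forall a b a' b', is_derive a t a' -> is_derive b t b' ->
    is_derive (fun s => a s * b s) t (a' * b t + a t * b')).
  { intros a b a' b' Ha Hb.
    apply (is_derive_mult a b t a' b' Ha Hb). intros; apply Rmult_comm. }
  intros (F1 & F2 & F3) (G1 & G2 & G3). unfold dot.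
  evar_last.
  - apply @is_derive_plus; [apply @is_derive_plus|]; apply M; eassumption.
  - unfold plus; simpl. ring.
Qed.

Lemma is_derive_eq_loc (f g : R -> R) t l m :
  locally t (fun s => f s = g s) -> is_derive f t l -> is_derive g t m -> l = m.
Proof.
  intros H Hf Hg. rewrite <- (is_derive_unique _ _ _ Hf), <- (is_derive_unique _ _ _ Hg).
  now apply Derive_ext_loc.
Qed.

Lemma open_square (U : R * R -> Prop) u v : open U -> U (u, v) ->
  exists e, 0 < e /\ forall s t, square u v e s t -> U (s, t).
Proof.
  intros HU H. destruct (HU (u, v) H) as [e He].
  exists e; split; [apply cond_pos|]. intros s t [Hs Ht]. apply He. split; assumption.
Qed.

Lemma open_slice_u (U : R * R -> Prop) u v : open U -> U (u, v) ->
  locally u (fun s => U (s, v)).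
Proof.
  intros HU H. destruct (open_square U u v HU H) as [e [He K]].
  exists (mkposreal e He). intros s Hs. apply K. split; [exact Hs|].
  rewrite Rminus_eq_0, Rabs_R0; assumption.
Qed.

Lemma open_slice_v (U : R * R -> Prop) u v : open U -> U (u, v) ->
  locally v (fun s => U (u, s)).
Proof.
  intros HU H. destruct (open_square U u v HU H) as [e [He K]].
  exists (mkposreal e He). intros s Hs. apply K. split; [|exact Hs].
  rewrite Rminus_eq_0, Rabs_R0; assumption.
Qed.

Definition coords (c : nat -> nat -> vec) (p : vec -> R) : nat -> nat -> R :=
  fun i j => p (c i j).

Definition poly_chart (c : nat -> nat -> vec) : chart := fun u v =>
  (bipoly (coords c vx) u v, bipoly (coords c vy) u v, bipoly (coords c vz) u v).

Definition vdu (c : nat -> nat -> vec) : nat -> nat -> vec :=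
  fun i j => scal (INR (S i)) (c (S i) j).
Definition vdv (c : nat -> nat -> vec) : nat -> nat -> vec :=
  fun i j => scal (INR (S j)) (c i (S j)).

Definition vquartic (c : nat -> nat -> vec) : Prop :=
  quartic (coords c vx) /\ quartic (coords c vy) /\ quartic (coords c vz).

Lemma vquartic_vdu c : vquartic c -> vquartic (vdu c).
Proof. intros (H1 & H2 & H3). exact (conj (quartic_du _ H1) (conj (quartic_du _ H2) (quartic_du _ H3))). Qed.
Lemma vquartic_vdv c : vquartic c -> vquartic (vdv c).
Proof. intros (H1 & H2 & H3). exact (conj (quartic_dv _ H1) (conj (quartic_dv _ H2) (quartic_dv _ H3))). Qed.

Lemma is_vderive_u c u v : vquartic c ->
  is_vderive (fun s => poly_chart c s v) u (poly_chart (vdu c) u v).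
Proof.
  intros (H1 & H2 & H3). exact (conj (is_derive_bipoly_u _ u v H1)
    (conj (is_derive_bipoly_u _ u v H2) (is_derive_bipoly_u _ u v H3))).
Qed.

Lemma is_vderive_v c u v : vquartic c ->
  is_vderive (fun s => poly_chart c u s) v (poly_chart (vdv c) u v).
Proof.
  intros (H1 & H2 & H3). exact (conj (is_derive_bipoly_v _ u v H1)
    (conj (is_derive_bipoly_v _ u v H2) (is_derive_bipoly_v _ u v H3))).
Qed.

Definition agree_on (U : R * R -> Prop) (x y : chart) : Prop :=
  forall u v, U (u, v) -> x u v = y u v.

Lemma d_u_agree U x c : open U -> vquartic c -> agree_on U x (poly_chart c) ->
  agree_on U (d_u x) (poly_chart (vdu c)).
Proof.
  intros HU Hc H u v Huv. destruct (is_vderive_u c u v Hc) as (D1 & D2 & D3).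
  apply vec_ext; [rewrite <- (is_derive_unique _ _ _ D1) | rewrite <- (is_derive_unique _ _ _ D2)
    | rewrite <- (is_derive_unique _ _ _ D3)]; unfold d_u; cbn [vx vy vz fst snd];
  apply Derive_ext_loc; generalize (open_slice_u U u v HU Huv); apply filter_imp;
  intros s Hs; now rewrite (H s v Hs).
Qed.

Lemma d_v_agree U x c : open U -> vquartic c -> agree_on U x (poly_chart c) ->
  agree_on U (d_v x) (poly_chart (vdv c)).
Proof.
  intros HU Hc H u v Huv. destruct (is_vderive_v c u v Hc) as (D1 & D2 & D3).
  apply vec_ext; [rewrite <- (is_derive_unique _ _ _ D1) | rewrite <- (is_derive_unique _ _ _ D2)
    | rewrite <- (is_derive_unique _ _ _ D3)]; unfold d_v; cbn [vx vy vz fst snd];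
  apply Derive_ext_loc; generalize (open_slice_v U u v HU Huv); apply filter_imp;
  intros s Hs; now rewrite (H u s Hs).
Qed.

Lemma vdu_vdv c : vdu (vdv c) = vdv (vdu c).
Proof.
  extensionality i; extensionality j. unfold vdu, vdv. vec_ring.
Qed.

(** Differentiating [E = G] and [F = 0] shows that the Laplacian of the chart is
    orthogonal to [x_u] and to [x_v].  In isothermal parameters the numerator of
    [H] is [E] times the normal component of the Laplacian, so minimality makes
    the Laplacian orthogonal to [cross x_u x_v] as well. *)
Lemma laplacian_chart_zero U x c :
  open U -> regular_on U x -> isothermal_on U x -> minimal_on U x ->
  vquartic c -> agree_on U x (poly_chart c) ->
  forall u v, U (u, v) ->
    plus (poly_chart (vdu (vdu c)) u v) (poly_chart (vdv (vdv c)) u v) = zero.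
Proof.
  intros HU Hreg Hiso Hmin Hc Hx u v Huv.
  pose proof (vquartic_vdu c Hc) as Bu. pose proof (vquartic_vdv c Hc) as Bv.
  pose proof (d_u_agree U x c HU Hc Hx) as Hu.
  pose proof (d_v_agree U x c HU Hc Hx) as Hv.
  pose proof (d_u_agree U _ _ HU Bu Hu u v Huv) as Huu.
  pose proof (d_v_agree U _ _ HU Bu Hu u v Huv) as Huv'.
  pose proof (d_v_agree U _ _ HU Bv Hv u v Huv) as Hvv.
  assert (EG : forall s t, U (s, t) ->
     dot (poly_chart (vdu c) s t) (poly_chart (vdu c) s t) = dot (poly_chart (vdv c) s t) (poly_chart (vdv c) s t)).
  { intros s t H. rewrite <- (Hu s t H), <- (Hv s t H). apply (Hiso s t H). }
  assert (F0 : forall s t, U (s, t) ->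
     dot (poly_chart (vdu c) s t) (poly_chart (vdv c) s t) = 0).
  { intros s t H. rewrite <- (Hu s t H), <- (Hv s t H). apply (Hiso s t H). }
  assert (EGu := is_derive_eq_loc _ _ _ _ _
    (filter_imp _ _ (fun s => EG s v) (open_slice_u U u v HU Huv))
    (is_derive_dot _ _ _ _ _ (is_vderive_u _ u v Bu) (is_vderive_u _ u v Bu))
    (is_derive_dot _ _ _ _ _ (is_vderive_u _ u v Bv) (is_vderive_u _ u v Bv))).
  assert (EGv := is_derive_eq_loc _ _ _ _ _
    (filter_imp _ _ (fun s => EG u s) (open_slice_v U u v HU Huv))
    (is_derive_dot _ _ _ _ _ (is_vderive_v _ u v Bu) (is_vderive_v _ u v Bu))
    (is_derive_dot _ _ _ _ _ (is_vderive_v _ u v Bv) (is_vderive_v _ u v Bv))).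
  assert (Fu := is_derive_eq_loc _ _ _ _ _
    (filter_imp _ _ (fun s => F0 s v) (open_slice_u U u v HU Huv))
    (is_derive_dot _ _ _ _ _ (is_vderive_u _ u v Bu) (is_vderive_u _ u v Bv))
    (is_derive_const 0 u)).
  assert (Fv := is_derive_eq_loc _ _ _ _ _
    (filter_imp _ _ (fun s => F0 u s) (open_slice_v U u v HU Huv))
    (is_derive_dot _ _ _ _ _ (is_vderive_v _ u v Bu) (is_vderive_v _ u v Bv))
    (is_derive_const 0 v)).
  rewrite !vdu_vdv in *. change (zero : R) with 0 in Fu, Fv.
  pose proof (Hreg u v Huv) as Hn. pose proof (Hmin u v Huv) as Hm.
  specialize (EG u v Huv). specialize (F0 u v Huv).
  unfold mean_curvature, coefE, coefF, coefG, coefL, coefM, coefN, unit_normal in Hm.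
  rewrite Huu, Huv', Hvv, (Hu u v Huv), (Hv u v Huv) in Hm.
  rewrite (Hu u v Huv), (Hv u v Huv) in Hn.
  clear Huu Huv' Hvv Hu Hv.
  set (p := poly_chart (vdu c) u v) in *. set (q := poly_chart (vdv c) u v) in *.
  set (r := poly_chart (vdu (vdu c)) u v) in *.
  set (s := poly_chart (vdv (vdu c)) u v) in *.
  set (t := poly_chart (vdv (vdv c)) u v) in *.
  assert (Hpos := dot_self_pos _ Hn). assert (HL := dot_cross_self p q).
  assert (Comm : forall a b, dot a b = dot b a) by (intros; unfold dot; ring).
  apply (orthogonal_to_basis p q); auto.
  - rewrite (Comm q s) in *. rewrite (Comm p t) in *. rewrite (Comm p r) in *.
    rewrite (Comm p s) in *.
    replace (dot (plus r t) p) with (dot r p + dot t p) by vec_ring. lra.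
  - rewrite (Comm q s) in *. rewrite (Comm q t) in *. rewrite (Comm p t) in *.
    rewrite (Comm p s) in *. rewrite (Comm p r) in *.
    replace (dot (plus r t) q) with (dot r q + dot t q) by vec_ring. lra.
  - rewrite <- EG, F0 in Hm, HL.
    set (n := cross p q) in *. set (E := dot p p) in *.
    assert (HE : E <> 0) by (intro K; rewrite K in HL; lra).
    assert (HS := sqrt_lt_R0 _ Hpos).
    set (d := sqrt (dot n n)) in *.
    replace (dot (plus r t) n) with (dot n r + dot n t) by vec_ring.
    replace (dot (scal (/ d) n) t) with (/ d * dot n t) in Hm by vec_ring.
    replace (dot (scal (/ d) n) r) with (/ d * dot n r) in Hm by vec_ring.
    replace (dot n r + dot n t) with (2 * E * d *
      ((E * (/ d * dot n t) - 2 * 0 * dot (scal (/ d) n) s + E * (/ d * dot n r)) /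
       (2 * (E * E - 0 ^ 2)))) by (field; lra).
    rewrite Hm; ring.
Qed.

Lemma harmonic_of_laplacian c u0 v0 e : 0 < e -> quartic c ->
  (forall u v, square u0 v0 e u v ->
     bipoly (du (du c)) u v + bipoly (dv (dv c)) u v = 0) ->
  harmonic c.
Proof.
  intros He Hc H. split; auto. apply bipoly_zero with (1 := He) (u0 := u0) (v0 := v0).
  intros u v Huv. rewrite <- (H u v Huv). apply bipoly_plus.
Qed.

(** * Integrals of cubics *)

Lemma is_RInt_real_cubic (a b c d : R) :
  is_RInt (fun t : R => a + t * (b + t * (c + t * d))) 0 1 (a + b / 2 + c / 3 + d / 4).
Proof.
  evar_last.
  - apply (is_RInt_derive (fun t : R => a * t + b / 2 * t ^ 2 + c / 3 * t ^ 3 + d / 4 * t ^ 4)).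
    + intros t _. auto_derive; auto. field.
    + intros t _. apply (ex_derive_continuous (V := R_NormedModule)). auto_derive; auto.
  - unfold minus, plus, opp; simpl. field.
Qed.

Lemma RInt_cubic (q : nat -> C) :
  RInt (V := C_R_CompleteNormedModule) (fun t : R => cubic q (RtoC t)) 0 1 = antideriv q 1%C.
Proof.
  apply is_RInt_unique.
  replace (antideriv q 1%C) with
    (fst (q 0%nat) + fst (q 1%nat) / 2 + fst (q 2%nat) / 3 + fst (q 3%nat) / 4,
     snd (q 0%nat) + snd (q 1%nat) / 2 + snd (q 2%nat) / 3 + snd (q 3%nat) / 4)
    by (apply injective_projections; simpl; field).
  apply (is_RInt_fct_extend_pair (U := R_NormedModule) (V := R_NormedModule)).
  - eapply is_RInt_ext; [|apply is_RInt_real_cubic].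
    intros t _. simpl. ring.
  - eapply is_RInt_ext; [|apply is_RInt_real_cubic].
    intros t _. simpl. ring.
Qed.

(** Along the segment the integrand is a cubic in the real parameter, whose
    coefficients come from Taylor's formula at [z0]. *)
Lemma CInt_cubic (h : C -> C) (b : nat -> C) (z0 z : C) :
  (forall w, h w = cubic b w) ->
  CInt h z0 z = (antideriv b z - antideriv b z0)%C.
Proof.
  intro H. set (d := (z - z0)%C).
  set (q := fun n => match n with
    | 0%nat => cubic b z0
    | 1%nat => (d * (b 1%nat + z0 * (2 * b 2%nat + 3 * z0 * b 3%nat)))%C
    | 2%nat => (d * d * (b 2%nat + 3 * z0 * b 3%nat))%C
    | _ => (d * d * d * b 3%nat)%C
    end).
  unfold CInt. fold d.
  rewrite (RInt_ext (V := C_R_CompleteNormedModule) _ (fun t : R => cubic q (RtoC t))).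
  - rewrite RInt_cubic. unfold antideriv, q, cubic, d.
    field.
  - intros t _. rewrite H. unfold q, cubic.
    match goal with |- ?l = ?r => change (@eq C l r) end.
    unfold d. ring.
Qed.

(** * Isotropic cubic curves *)

(** The coefficients of the product of two cubics, listed up to degree 6. *)
Definition conv (a b : nat -> C) (k : nat) : C :=
  match k with
  | 0%nat => (a 0%nat * b 0%nat)%C
  | 1%nat => (a 0%nat * b 1%nat + a 1%nat * b 0%nat)%C
  | 2%nat => (a 0%nat * b 2%nat + a 1%nat * b 1%nat + a 2%nat * b 0%nat)%C
  | 3%nat => (a 0%nat * b 3%nat + a 1%nat * b 2%nat + a 2%nat * b 1%nat + a 3%nat * b 0%nat)%C
  | 4%nat => (a 1%nat * b 3%nat + a 2%nat * b 2%nat + a 3%nat * b 1%nat)%C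
  | 5%nat => (a 2%nat * b 3%nat + a 3%nat * b 2%nat)%C
  | _ => (a 3%nat * b 3%nat)%C
  end.

Definition sum_squares (a b c : nat -> C) : list C :=
  map (fun k => conv a a k + conv b b k + conv c c k)%C (seq 0 7).

Lemma horner_sum_squares (a b c : nat -> C) (z : C) :
  horner (sum_squares a b c) z =
  (cubic a z * cubic a z + cubic b z * cubic b z + cubic c z * cubic c z)%C.
Proof. unfold cubic, sum_squares. cbn [map seq horner]. unfold conv. ring. Qed.

Definition isotropic (a b c : nat -> C) : Prop :=
  forall z,
    (cubic a z * cubic a z + cubic b z * cubic b z + cubic c z * cubic c z)%C = 0%C.

Lemma isotropic_of_infinite (a b c : nat -> C) (S : C -> Prop) :
  infinite S ->
  (forall z, S z ->
    (cubic a z * cubic a z + cubic b z * cubic b z + cubic c z * cubic c z)%C = 0%C) ->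
  isotropic a b c.
Proof.
  intros HS H z. rewrite <- horner_sum_squares.
  apply horner_zero_ext with (1 := HS).
  intros w Hw. rewrite horner_sum_squares; auto.
Qed.

Lemma isotropic_coefs (a b c : nat -> C) : isotropic a b c ->
  forall k, (k < 7)%nat -> (conv a a k + conv b b k + conv c c k)%C = 0%C.
Proof.
  intros H k Hk.
  assert (K : List.Forall (fun y : C => y = 0%C) (sum_squares a b c)).
  { apply horner_coef_zero_all. intro z. rewrite horner_sum_squares; apply H. }
  rewrite Forall_forall in K. apply K.
  apply in_map_iff. exists k; split; auto. apply in_seq; lia.
Qed.

Lemma Ci_sqr : (Ci * Ci)%C = (- (1))%C.
Proof. apply injective_projections; simpl; ring. Qed.

Lemma Cmult_nonzero (a b : C) : a <> 0%C -> b <> 0%C -> (a * b)%C <> 0%C.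
Proof. intros Ha Hb H; destruct (Cmult_zero a b H); tauto. Qed.

Lemma horner_null (w a b c d e : C) :
  a = 0%C -> b = 0%C -> c = 0%C -> d = 0%C -> e = 0%C -> horner [a; b; c; d; e] w = 0%C.
Proof. intros; subst; simpl; ring. Qed.

Lemma C2_neq : RtoC 2 <> 0%C.
Proof. intro H; apply (f_equal fst) in H; simpl in H; lra. Qed.

Lemma Csqr_zero (a : C) : (a * a)%C = 0%C -> a = 0%C.
Proof. intro H; destruct (Cmult_zero _ _ H); auto. Qed.

(** With [F = a - i b] and [K = a + i b], isotropy reads [F K = - c^2].  The
    leading coefficients make [K] of degree exactly 3 and [c] of degree at most
    2; comparing the degrees of [F K] and [c^2], [F] has degree at most 1, and
    exactly 1 unless [c = 0], the degree of [c^2] being even.  The root of [F] is then a root of [c], so [c = F g] with [g] of degree 1, and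
    [K = - F g^2]; solving for [a] and [b] gives the Weierstrass data [F], [g]. *)
Lemma isotropic_cubic_weierstrass (a b c : nat -> C) (r : C) :
  r <> 0%C -> a 3%nat = (- r)%C -> b 3%nat = (Ci * r)%C -> c 3%nat = 0%C ->
  isotropic a b c ->
  (exists n, (n < 4)%nat /\ c n <> 0%C) ->
  exists A B C0 D : C, A <> 0%C /\ C0 <> 0%C /\
    let f := fun w => (A * w + B)%C in
    let g := fun w => (C0 * w + D)%C in
    forall w,
      (RtoC (1 / 2) * f w * (1 - g w * g w))%C = cubic a w /\
      (Ci / 2 * f w * (1 + g w * g w))%C = cubic b w /\
      (f w * g w)%C = cubic c w.
Proof.
  intros Hr Ha3 Hb3 Hc3 Hiso Hc. assert (Hsum := isotropic_coefs a b c Hiso).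
  set (F := fun n => (a n - Ci * b n)%C).
  set (K := fun n => (a n + Ci * b n)%C).
  assert (HFK : forall k, (k < 7)%nat -> (conv F K k + conv c c k)%C = 0%C).
  { intros k Hk. rewrite <- (Hsum k Hk).
    assert (I := Ci_sqr).
    replace (conv b b k) with (- (Ci * Ci) * conv b b k)%C by (rewrite I; ring).
    unfold F, K. do 7 (destruct k as [|k]; [simpl; ring|]). lia. }
  assert (F3 : F 3%nat = 0%C).
  { unfold F. rewrite Ha3, Hb3. replace (- r - Ci * (Ci * r))%C with (- r - (Ci * Ci) * r)%C by ring.
    rewrite Ci_sqr. ring. }
  assert (K3 : K 3%nat <> 0%C).
  { unfold K. rewrite Ha3, Hb3. replace (- r + Ci * (Ci * r))%C with (- r + (Ci * Ci) * r)%C by ring.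
    rewrite Ci_sqr. replace (- r + - (1) * r)%C with (- (1) * (2 * r))%C by ring.
    apply Cmult_nonzero; [intro E; apply (f_equal fst) in E; simpl in E; lra|].
    apply Cmult_nonzero; auto using C2_neq. }
  assert (Ea : forall n, a n = ((F n + K n) / 2)%C).
  { intro n. unfold F, K. field. }
  assert (Eb : forall n, b n = (Ci * (F n - K n) / 2)%C).
  { intro n. unfold F, K. replace (Ci * (a n - Ci * b n - (a n + Ci * b n)) / 2)%C with (- (Ci * Ci) * b n)%C.
    - rewrite Ci_sqr; ring.
    - field. }
  clearbody F K.
  pose proof (HFK 0%nat ltac:(lia)) as E0. pose proof (HFK 1%nat ltac:(lia)) as E1.
  pose proof (HFK 2%nat ltac:(lia)) as E2. pose proof (HFK 3%nat ltac:(lia)) as E3.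
  pose proof (HFK 4%nat ltac:(lia)) as E4. pose proof (HFK 5%nat ltac:(lia)) as E5.
  clear HFK Hsum Hiso. unfold conv in *. rewrite F3, Hc3 in *.
  assert (F2 : F 2%nat = 0%C).
  { destruct (Cmult_zero (F 2%nat) (K 3%nat)) as [|?]; try tauto. rewrite <- E5; ring. }
  rewrite F2 in *.
  assert (F1 : F 1%nat <> 0%C).
  { intro F1. rewrite F1 in *.
    assert (c2 : c 2%nat = 0%C) by (apply Csqr_zero; rewrite <- E4; ring).
    rewrite c2 in *.
    assert (F0 : F 0%nat = 0%C).
    { destruct (Cmult_zero (F 0%nat) (K 3%nat)) as [|?]; try tauto. rewrite <- E3; ring. }
    rewrite F0 in *.
    assert (c1 : c 1%nat = 0%C) by (apply Csqr_zero; rewrite <- E2; ring).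
    assert (c0 : c 0%nat = 0%C) by (apply Csqr_zero; rewrite <- E0; ring).
    destruct Hc as [[|[|[|[|n]]]] [Hn Hc]]; auto; lia. }
  set (C0 := (c 2%nat / F 1%nat)%C).
  set (D := ((c 1%nat - C0 * F 0%nat) / F 1%nat)%C).
  assert (c2 : c 2%nat = (F 1%nat * C0)%C) by (unfold C0; field; auto).
  assert (c1 : c 1%nat = (F 1%nat * D + F 0%nat * C0)%C) by (unfold D; field; auto).
  assert (c0 : c 0%nat = (F 0%nat * D)%C).
  { (* [c] vanishes at the root [w] of [F] *)
    set (w := (- F 0%nat / F 1%nat)%C).
    assert (Hw : (F 0%nat + w * F 1%nat)%C = 0%C) by (unfold w; field; auto).
    assert (Z : cubic c w = 0%C).
    { apply Csqr_zero.
      transitivity (- ((F 0%nat + w * F 1%nat) * cubic K w))%C; [|rewrite Hw; ring].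
      replace (cubic c w * cubic c w)%C with
       (cubic c w * cubic c w + (F 0%nat + w * F 1%nat) * cubic K w
         - (F 0%nat + w * F 1%nat) * cubic K w)%C by ring.
      match goal with |- (?X - ?Y)%C = _ => assert (HX : X = 0%C) end.
      { unfold cubic. rewrite Hc3.
        etransitivity; [|exact (horner_null w _ _ _ _ _ E0 E1 E2 E3 E4)].
        simpl. ring. }
      rewrite HX. ring. }
    unfold cubic in Z. rewrite Hc3, c2, c1 in Z.
    replace (c 0%nat) with ((c 0%nat + w * (F 1%nat * D + F 0%nat * C0 + w * (F 1%nat * C0 + w * 0))) - (F 0%nat + w * F 1%nat) * (D + w * C0) + F 0%nat * D)%C by ring.
    rewrite Z, Hw. ring. }
  clearbody C0 D. rewrite c0, c1, c2 in *.
  assert (cancel : forall y : C, (F 1%nat * y)%C = 0%C -> y = 0%C).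
  { intros y Hy. destruct (Cmult_zero _ _ Hy); tauto. }
  (* the coefficients of [K + F g^2], from the top, by cancelling [F] in [F (K + F g^2) = 0] *)
  assert (M3 : (K 3%nat + F 1%nat * C0 * C0)%C = 0%C).
  { apply cancel. rewrite <- E4. ring. }
  assert (M2 : (K 2%nat + (2 * F 1%nat * C0 * D + F 0%nat * C0 * C0))%C = 0%C).
  { apply cancel. transitivity (- F 0%nat * (K 3%nat + F 1%nat * C0 * C0))%C; [|rewrite M3; ring].
    rewrite <- (Cplus_0_r (- F 0%nat * _)%C), <- E3. ring. }
  assert (M1 : (K 1%nat + (F 1%nat * D * D + 2 * F 0%nat * C0 * D))%C = 0%C).
  { apply cancel. transitivity (- F 0%nat * (K 2%nat + (2 * F 1%nat * C0 * D + F 0%nat * C0 * C0)))%C; [|rewrite M2; ring].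
    rewrite <- (Cplus_0_r (- F 0%nat * _)%C), <- E2. ring. }
  assert (M0 : (K 0%nat + F 0%nat * D * D)%C = 0%C).
  { apply cancel. transitivity (- F 0%nat * (K 1%nat + (F 1%nat * D * D + 2 * F 0%nat * C0 * D)))%C; [|rewrite M1; ring].
    rewrite <- (Cplus_0_r (- F 0%nat * _)%C), <- E1. ring. }
  assert (HC0 : C0 <> 0%C).
  { intro E. rewrite E in M3. apply K3. rewrite <- M3. ring. }
  exists (F 1%nat), (F 0%nat), C0, D. split; [exact F1 | split; [exact HC0|]].
  cbn zeta. intro w. set (f := fun w : C => (F 1%nat * w + F 0%nat)%C). set (g := fun w : C => (C0 * w + D)%C).
  change ((RtoC (1 / 2) * f w * (1 - g w * g w))%C = cubic a w /\ (Ci / 2 * f w * (1 + g w * g w))%C = cubic b w /\ (f w * g w)%C = cubic c w).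
  assert (HF : cubic F w = f w) by (unfold cubic, f; rewrite F2, F3; ring).
  assert (HK : cubic K w = (- (f w * g w * g w))%C).
  { assert (N := horner_null w _ _ _ _ _ M0 M1 M2 M3 eq_refl).
    replace (cubic K w) with (cubic K w + f w * g w * g w - f w * g w * g w)%C by ring.
    match type of N with ?X = _ => replace (cubic K w + f w * g w * g w)%C with X end.
    - rewrite N; ring.
    - unfold f, g, cubic. cbn [horner]. ring. }
  repeat split.
  - replace (RtoC (1 / 2)) with (/ 2)%C by (apply injective_projections; simpl; field).
    transitivity ((cubic F w + cubic K w) / 2)%C;
      [rewrite HF, HK | unfold cubic; rewrite !Ea]; field.
  - transitivity (Ci * (cubic F w - cubic K w) / 2)%C; [rewrite HF, HK | unfold cubic; rewrite !Eb];
      field.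
  - unfold cubic, f, g. rewrite c0, c1, c2, Hc3. ring.
Qed.

(** * Orthonormal frames *)

Definition orthonormal (e1 e2 : vec) : Prop :=
  dot e1 e1 = 1 /\ dot e2 e2 = 1 /\ dot e1 e2 = 0.

(** The rotation that maps the standard basis to [e1], [e2], [cross e1 e2]. *)
Definition from_frame (e1 e2 : vec) (p : vec) : vec :=
  plus (plus (scal (vx p) e1) (scal (vy p) e2)) (scal (vz p) (cross e1 e2)).

Definition to_frame (e1 e2 : vec) (p : vec) : vec :=
  (dot e1 p, dot e2 p, dot (cross e1 e2) p).

Lemma double_cross (p q r : vec) :
  cross (cross p q) r = plus (scal (dot p r) q) (scal (- dot q r) p).
Proof. vec_ring. Qed.

Lemma frame_cross e1 e2 : orthonormal e1 e2 ->
  cross e2 (cross e1 e2) = e1 /\ cross (cross e1 e2) e1 = e2 /\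
  dot (cross e1 e2) (cross e1 e2) = 1.
Proof.
  intros (H1 & H2 & H3). rewrite dot_cross_self, H1, H2, H3.
  repeat split; [| |ring].
  - replace (cross e2 (cross e1 e2)) with
      (plus (scal (dot e2 e2) e1) (scal (- dot e1 e2) e2)) by vec_ring.
    rewrite H2, H3. vec_ring.
  - rewrite double_cross. replace (dot e2 e1) with (dot e1 e2) by vec_ring.
    rewrite H1, H3. vec_ring.
Qed.

Lemma from_to_frame e1 e2 p : orthonormal e1 e2 ->
  from_frame e1 e2 (to_frame e1 e2 p) = p.
Proof.
  intro H. destruct (frame_cross e1 e2 H) as (H1 & H2 & H3).
  assert (K := cross_basis e1 e2 p). rewrite H1, H2, H3 in K.
  transitivity (scal 1 p : vec); [rewrite K|]; unfold from_frame, to_frame; vec_ring.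
Qed.

Lemma parseval e1 e2 p q : orthonormal e1 e2 ->
  dot (to_frame e1 e2 p) (to_frame e1 e2 q) = dot p q.
Proof.
  intro H. rewrite <- (from_to_frame e1 e2 q H) at 2.
  unfold from_frame, to_frame. vec_ring.
Qed.

Lemma is_linear_from_frame e1 e2 : is_linear (from_frame e1 e2).
Proof.
  assert (S : forall (f : vec -> R) (e : vec), is_linear f -> is_linear (fun p => scal (f p) e : vec)).
  { intros f e Hf. apply (is_linear_comp f (fun k : R => scal k e)); auto.
    apply @is_linear_scal_l. }
  assert (P : forall f g : vec -> vec, is_linear f -> is_linear g ->
     is_linear (fun p => plus (f p) (g p) : vec)).
  { intros f g Hf Hg.
    apply (is_linear_comp (fun p => (f p, g p)) (fun w : vec * vec => plus (fst w) (snd w))).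
    - now apply is_linear_prod.
    - apply @is_linear_plus. }
  unfold from_frame.
  apply P; [apply P|]; apply S.
  - apply (is_linear_comp (fun p : vec => fst p) (fun p : R * R => fst p));
      apply @is_linear_fst.
  - apply (is_linear_comp (fun p : vec => fst p) (fun p : R * R => snd p));
      [apply @is_linear_fst | apply @is_linear_snd].
  - apply @is_linear_snd.
Qed.

Lemma from_frame_rigid e1 e2 b : orthonormal e1 e2 ->
  rigid_motion (fun p => plus (from_frame e1 e2 p) b).
Proof.
  intro H. exists (from_frame e1 e2), b. destruct (frame_cross e1 e2 H) as (H1 & H2 & H3).
  split; [apply is_linear_from_frame | split; [|split; [|reflexivity]]].
  - intros p q. destruct H as (E1 & E2 & E12).
    assert (E13 : dot e1 (cross e1 e2) = 0) by vec_ring.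
    assert (E23 : dot e2 (cross e1 e2) = 0) by vec_ring.
    unfold from_frame. set (e3 := cross e1 e2) in *.
    transitivity (vx p * vx q * dot e1 e1 + vy p * vy q * dot e2 e2 + vz p * vz q * dot e3 e3
      + (vx p * vy q + vy p * vx q) * dot e1 e2
      + (vx p * vz q + vz p * vx q) * dot e1 e3
      + (vy p * vz q + vz p * vy q) * dot e2 e3).
    + clearbody e3. vec_ring.
    + rewrite E1, E2, E12, E13, E23, H3. unfold dot. ring.
  - intros p q. unfold from_frame at 2 3.
    set (e3 := cross e1 e2) in *.
    transitivity (plus (plus (scal (vx (cross p q)) (cross e2 e3)) (scal (vy (cross p q)) (cross e3 e1)))
       (scal (vz (cross p q)) (cross e1 e2))).
    + rewrite H1, H2. reflexivity.
    + clearbody e3. vec_ring.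
Qed.

(** * Cubic curves in a rotated frame *)

(** The component along a real vector [e] of the complex curve with coordinate
    coefficients [b1], [b2], [b3]. *)
Definition along (e : vec) (b1 b2 b3 : nat -> C) (n : nat) : C :=
  (vx e * b1 n + vy e * b2 n + vz e * b3 n)%C.

Lemma cubic_along e b1 b2 b3 z :
  cubic (along e b1 b2 b3) z =
  (vx e * cubic b1 z + vy e * cubic b2 z + vz e * cubic b3 z)%C.
Proof. unfold cubic, along. ring. Qed.

Definition re_antideriv (b1 b2 b3 : nat -> C) (z : C) : vec :=
  (Re (antideriv b1 z), Re (antideriv b2 z), Re (antideriv b3 z)).

Lemma re_antideriv_along e b1 b2 b3 z :
  Re (antideriv (along e b1 b2 b3) z) = dot e (re_antideriv b1 b2 b3 z).
Proof.
  transitivity (Re (vx e * antideriv b1 z + vy e * antideriv b2 z + vz e * antideriv b3 z)%C).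
  - f_equal. unfold antideriv, along, Cdiv. ring.
  - unfold dot, re_antideriv, vx, vy, vz. simpl. ring.
Qed.

(** The bilinear square of a complex vector is a combination of real dot products
    of its real and imaginary parts, so a real rotation preserves it. *)
Lemma along_frame_squares e1 e2 (a b c : C) : orthonormal e1 e2 ->
  let y e := (vx e * a + vy e * b + vz e * c)%C in
  (y e1 * y e1 + y e2 * y e2 + y (cross e1 e2) * y (cross e1 e2))%C = (a * a + b * b + c * c)%C.
Proof.
  intros H y. set (p := (fst a, fst b, fst c) : vec). set (q := (snd a, snd b, snd c) : vec).
  assert (Y : forall e, y e = (dot e p, dot e q)).
  { intro e. unfold y, dot, p, q. apply injective_projections; simpl; unfold vx, vy, vz; simpl; ring. }
  rewrite !Y.
  transitivity ((dot (to_frame e1 e2 p) (to_frame e1 e2 p) - dot (to_frame e1 e2 q) (to_frame e1 e2 q),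
      2 * dot (to_frame e1 e2 p) (to_frame e1 e2 q)) : C).
  - unfold to_frame. generalize (cross e1 e2); intro e3.
    apply injective_projections; vec_coords; simpl; ring.
  - rewrite !parseval by auto. unfold p, q.
    apply injective_projections; vec_coords; simpl; ring.
Qed.

(** The real and imaginary parts of an isotropic vector are orthogonal and of the
    same length, so up to scaling they form part of an orthonormal frame.  The
    sign of [e1] puts the vector in the direction [(-1, i, 0)], which is that of
    the leading coefficient of the Weierstrass integrand for linear [f] and [g]. *)
Lemma isotropic_frame (a b c : C) :
  (a * a + b * b + c * c)%C = 0%C ->
  (fst a, fst b, fst c) <> (zero : vec) ->
  exists (e1 e2 : vec) (r : R), orthonormal e1 e2 /\ r <> 0 /\
    let y e := (vx e * a + vy e * b + vz e * c)%C in
    y e1 = (- r)%C /\ y e2 = (Ci * r)%C /\ y (cross e1 e2) = 0%C.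
Proof.
  intros H Hz. set (p := (fst a, fst b, fst c) : vec). set (q := (snd a, snd b, snd c) : vec).
  fold p in Hz. assert (Hp := dot_self_pos p Hz).
  assert (Hq : dot q q = dot p p).
  { apply (f_equal fst) in H. simpl in H. unfold p, q. vec_coords. lra. }
  assert (Hpq : dot p q = 0).
  { apply (f_equal snd) in H. simpl in H. unfold p, q. vec_coords. lra. }
  assert (Hr := sqrt_lt_R0 _ Hp). assert (Hr2 := sqrt_sqrt _ (Rlt_le _ _ Hp)).
  set (r := sqrt (dot p p)) in *.
  assert (Hr0 : r <> 0) by lra.
  exists (scal (- / r) p), (scal (/ r) q), r.
  assert (D1 : dot (scal (- / r) p) p = - r).
  { replace (dot (scal (- / r) p) p) with (- / r * dot p p) by vec_ring.
    rewrite <- Hr2. field; auto. }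
  assert (D2 : dot (scal (/ r) q) q = r).
  { replace (dot (scal (/ r) q) q) with (/ r * dot q q) by vec_ring.
    rewrite Hq, <- Hr2. field; auto. }
  assert (D12 : dot (scal (- / r) p) q = 0).
  { replace (dot (scal (- / r) p) q) with (- / r * dot p q) by vec_ring.
    rewrite Hpq; ring. }
  assert (D21 : dot (scal (/ r) q) p = 0).
  { replace (dot (scal (/ r) q) p) with (/ r * dot p q) by vec_ring.
    rewrite Hpq; ring. }
  split; [|split; [auto|]].
  - split; [|split].
    + replace (dot (scal (- / r) p) (scal (- / r) p)) with (- / r * dot (scal (- / r) p) p) by vec_ring.
      rewrite D1; field; auto.
    + replace (dot (scal (/ r) q) (scal (/ r) q)) with (/ r * dot (scal (/ r) q) q) by vec_ring.
      rewrite D2; field; auto.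
    + replace (dot (scal (- / r) p) (scal (/ r) q)) with (/ r * dot (scal (- / r) p) q) by vec_ring.
      rewrite D12; ring.
  - intro y.
    assert (Y : forall e, y e = (dot e p, dot e q)).
    { intro e. unfold y, dot, p, q. apply injective_projections; simpl; unfold vx, vy, vz; simpl; ring. }
    rewrite !Y, D1, D2, D12, D21. repeat split.
    + apply injective_projections; simpl; ring.
    + apply injective_projections; simpl; ring.
    + apply injective_projections; simpl; clear -p q; vec_ring.
Qed.

(** Rotating so that the leading coefficient becomes a multiple of [(-1, i, 0)],
    either the third component vanishes, and the real part of the primitive stays
    in the plane orthogonal to [e3], or the Weierstrass data exist. *)
Lemma isotropic_cubic_planar_or_weierstrass (b1 b2 b3 : nat -> C) (z0 : C) :
  isotropic b1 b2 b3 ->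
  (fst (b1 3%nat), fst (b2 3%nat), fst (b3 3%nat)) <> (zero : vec) ->
  (exists n : vec, n <> zero /\ forall z, dot n (re_antideriv b1 b2 b3 z) = 0) \/
  (exists (T : vec -> vec) (A B C0 D : C),
    rigid_motion T /\ A <> 0%C /\ C0 <> 0%C /\
    forall u v : R,
      re_antideriv b1 b2 b3 (u, v) =
      T (weierstrass_chart (fun z => (A * z + B)%C) (fun z => (C0 * z + D)%C) z0 u v)).
Proof.
  intros Hall Hlead.
  destruct (isotropic_frame _ _ _ (isotropic_coefs _ _ _ Hall 6%nat ltac:(lia)) Hlead)
    as [e1 [e2 [r (He12 & Hr & Y1 & Y2 & Y3)]]].
  set (e3 := cross e1 e2) in *.
  destruct (classic (exists n, (n < 4)%nat /\ along e3 b1 b2 b3 n <> 0%C)) as [N | N].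
  - right.
    destruct (isotropic_cubic_weierstrass (along e1 b1 b2 b3) (along e2 b1 b2 b3)
      (along e3 b1 b2 b3) r) as (A & B & C0 & D & HA & HC & HW); auto.
    + intro E. apply RtoC_inj in E. auto.
    + intro z. rewrite !cubic_along.
      rewrite (along_frame_squares e1 e2 _ _ _ He12). apply Hall.
    + cbn zeta in HW. set (W0 := re_antideriv b1 b2 b3 z0).
      exists (fun p => plus (from_frame e1 e2 p) W0), A, B, C0, D.
      split; [now apply from_frame_rigid | split; [exact HA | split; [exact HC|]]].
      intros u v. unfold weierstrass_chart, weierstrass. cbn zeta. cbn [fst snd].
      rewrite (CInt_cubic _ _ z0 (u, v) (fun w => proj1 (HW w))).
      rewrite (CInt_cubic _ _ z0 (u, v) (fun w => proj1 (proj2 (HW w)))).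
      rewrite (CInt_cubic _ _ z0 (u, v) (fun w => proj2 (proj2 (HW w)))).
      set (W := re_antideriv b1 b2 b3 (u, v)).
      assert (Re_sub : forall a b : C, Re (a - b)%C = Re a - Re b) by reflexivity.
      rewrite !Re_sub, !re_antideriv_along. fold W W0.
      replace (dot e1 W - dot e1 W0, dot e2 W - dot e2 W0, dot e3 W - dot e3 W0)
        with (to_frame e1 e2 (plus W (scal (-1) W0)))
        by (clearbody W W0; unfold to_frame; fold e3; vec_ring).
      rewrite (from_to_frame e1 e2 _ He12). clearbody W W0. vec_ring.
  - left. exists e3. split.
    + intro E. destruct (frame_cross e1 e2 He12) as (_ & _ & K). fold e3 in K.
      rewrite E in K. revert K. unfold dot, vx, vy, vz, zero; simpl. unfold zero; simpl. lra.
    + intro z.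
      assert (Z : forall n, (n < 4)%nat -> along e3 b1 b2 b3 n = 0%C).
      { intros n Hn. apply NNPP; intro M. apply N; eauto. }
      rewrite <- re_antideriv_along. unfold antideriv. rewrite !Z by lia.
      simpl. field.
Qed.

(** * The representation theorem *)

(** Differentiation shifts the coefficient array, so entries outside the range of
    the sum would enter it; they are reset to zero. *)
Definition quartic_trim (c : nat -> nat -> vec) : nat -> nat -> vec := fun i j =>
  if andb (Nat.leb i 4) (Nat.leb j 4) then c i j else zero.

Lemma vquartic_trim c : vquartic (quartic_trim c).
Proof.
  assert (K : forall i j, (4 < i \/ 4 < j)%nat -> quartic_trim c i j = zero).
  { intros i j H. unfold quartic_trim.
    destruct (Nat.leb_spec i 4), (Nat.leb_spec j 4); simpl; auto; lia. }
  split; [|split]; intros i j H; unfold coords; rewrite K; auto.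
Qed.

Lemma sum_n_coord (p : vec -> R) (f : nat -> vec) n :
  (forall r s, p (plus r s) = p r + p s) ->
  p (sum_n f n) = sum_n (fun i => p (f i)) n.
Proof.
  intro H. induction n as [|n IH]; [now rewrite !sum_O|].
  rewrite !sum_Sn, H, IH. reflexivity.
Qed.

Lemma biquartic_trim c u v :
  sum_n (fun i => sum_n (fun j => scal (u ^ i * v ^ j) (c i j)) 4) 4 = poly_chart (quartic_trim c) u v.
Proof.
  assert (K : forall p : vec -> R, (forall r s, p (plus r s) = p r + p s) ->
    (forall k r, p (scal k r) = k * p r) ->
    p (sum_n (fun i => sum_n (fun j => scal (u ^ i * v ^ j) (c i j)) 4) 4)
     = bipoly (coords (quartic_trim c) p) u v).
  { intros p Hp Hs. unfold bipoly, coords. rewrite sum_n_coord by auto.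
    apply sum_n_ext_loc; intros i Hi. rewrite sum_n_coord by auto.
    apply sum_n_ext_loc; intros j Hj. rewrite Hs. unfold quartic_trim.
    apply Nat.leb_le in Hi, Hj. now rewrite Hi, Hj. }
  apply vec_ext; apply K; reflexivity.
Qed.

Lemma rigid_motion_translate (T : vec -> vec) (b : vec) :
  rigid_motion T -> rigid_motion (fun p => plus (T p) b).
Proof.
  intros (Q & b' & HQ & Hdot & Hcross & HT).
  exists Q, (plus b' b). repeat (split; [assumption|]).
  intro p. rewrite HT. symmetry. apply @plus_assoc.
Qed.

Theorem theorem1 (U : R * R -> Prop) (x : chart) (z0 : C)
  (hUopen : open U) (hUne : exists p : R * R, U p)
  (hreg : regular_on U x) (hbiq : biquartic_on U x)
  (hiso : isothermal_on U x) (hmin : minimal_on U x)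
  (hnonplanar : ~ planar_on U x) :
  exists (T : vec -> vec) (A B C0 D : C),
    rigid_motion T /\ A <> RtoC 0 /\ C0 <> RtoC 0 /\
    forall u v : R, U (u, v) ->
      x u v = T (weierstrass_chart (fun z => (A * z + B)%C)
                                   (fun z => (C0 * z + D)%C) z0 u v).
Proof.
  destruct hUne as [[u0 v0] H0].
  destruct hbiq as [c' ([j [Hj Hc]] & _ & Hx)].
  set (c := quartic_trim c').
  assert (Hq : vquartic c) by apply vquartic_trim.
  assert (Hc4 : c 4%nat j <> zero).
  { unfold c, quartic_trim. apply Nat.leb_le in Hj. now rewrite Hj. }
  assert (Hxc : agree_on U x (poly_chart c)).
  { intros u v Huv. rewrite (Hx u v Huv). apply biquartic_trim. }
  clearbody c. clear c' Hc Hx.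
  destruct (open_square U u0 v0 hUopen H0) as [e [He Hsq]].
  pose proof (laplacian_chart_zero U x c hUopen hreg hiso hmin Hq Hxc) as HL.
  destruct Hq as (Q1 & Q2 & Q3).
  assert (A1 : harmonic (coords c vx)).
  { apply harmonic_of_laplacian with (1 := He) (u0 := u0) (v0 := v0); auto.
    intros u v H. exact (f_equal vx (HL u v (Hsq u v H))). }
  assert (A2 : harmonic (coords c vy)).
  { apply harmonic_of_laplacian with (1 := He) (u0 := u0) (v0 := v0); auto.
    intros u v H. exact (f_equal vy (HL u v (Hsq u v H))). }
  assert (A3 : harmonic (coords c vz)).
  { apply harmonic_of_laplacian with (1 := He) (u0 := u0) (v0 := v0); auto.
    intros u v H. exact (f_equal vz (HL u v (Hsq u v H))). }
  set (b1 := wirtinger (coords c vx)). set (b2 := wirtinger (coords c vy)).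
  set (b3 := wirtinger (coords c vz)).
  assert (Hrep : forall u v, U (u, v) -> x u v = plus (re_antideriv b1 b2 b3 (u, v)) (c 0%nat 0%nat)).
  { intros u v Huv. rewrite (Hxc u v Huv). unfold poly_chart, b1, b2, b3.
    rewrite !antideriv_eval by auto. apply vec_ext; vec_coords; unfold coords, re_antideriv;
    vec_coords; unfold vx, vy, vz; simpl; ring. }
  assert (Hiso : forall u v, U (u, v) ->
    (cubic b1 (u, v) * cubic b1 (u, v) + cubic b2 (u, v) * cubic b2 (u, v) +
     cubic b3 (u, v) * cubic b3 (u, v))%C = 0%C).
  { intros u v Huv. unfold b1, b2, b3. rewrite !wirtinger_eval by auto.
    destruct (hiso u v Huv) as [I1 I2]. unfold coefE, coefF, coefG in I1, I2.
    assert (Hq : vquartic c) by (split; auto).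
    rewrite (d_u_agree U x c hUopen Hq Hxc u v Huv), (d_v_agree U x c hUopen Hq Hxc u v Huv) in I1, I2.
    unfold poly_chart in I1, I2. vec_coords.
    change (coords (vdu c) ?p) with (du (coords c p)) in I1, I2.
    change (coords (vdv c) ?p) with (dv (coords c p)) in I1, I2.
    apply injective_projections; simpl; lra. }
  assert (Hall : isotropic b1 b2 b3).
  { apply isotropic_of_infinite
      with (1 := infinite_segment v0 (u0 - e) (u0 + e) ltac:(lra)).
    intros z [t [Ht ->]]. apply Hiso, Hsq. split; apply Rabs_def1; lra. }
  assert (Hlead : (fst (b1 3%nat), fst (b2 3%nat), fst (b3 3%nat)) <> (zero : vec)).
  { (* total degree at most 4 leaves [u ^ 4] as the only term of degree 4 in [u] *)
    intro Z. apply Hc4.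
    assert (L : forall p : vec -> R, harmonic (coords c p) ->
      fst (wirtinger (coords c p) 3%nat) = 0 -> p (c 4%nat j) = 0).
    { intros p Hp Hw. destruct (harmonic_coefs _ Hp) as [K _].
      destruct j as [|k]; [|apply (K 4%nat (S k)); lia].
      unfold wirtinger, du, coords in Hw. simpl in Hw. lra. }
    apply vec_ext; apply L; auto;
      [apply (f_equal vx) in Z | apply (f_equal vy) in Z | apply (f_equal vz) in Z]; exact Z. }
  destruct (isotropic_cubic_planar_or_weierstrass b1 b2 b3 z0 Hall Hlead)
    as [[n [Hn Hplane]] | (T & A & B & C0 & D & HT & HA & HC & HW)].
  - contradict hnonplanar. exists n, (dot n (c 0%nat 0%nat)). split; auto.
    intros u v Huv. rewrite Hrep by auto.
    replace (dot n (plus (re_antideriv b1 b2 b3 (u, v)) (c 0%nat 0%nat))) with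
      (dot n (re_antideriv b1 b2 b3 (u, v)) + dot n (c 0%nat 0%nat))
      by (unfold re_antideriv; vec_ring).
    rewrite Hplane. ring.
  - exists (fun p => plus (T p) (c 0%nat 0%nat)), A, B, C0, D.
    split; [now apply rigid_motion_translate | split; [exact HA | split; [exact HC|]]].
    intros u v Huv. rewrite (Hrep u v Huv), (HW u v). reflexivity.
Qed.
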